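(* Let $\lambda,\mu$ be two partitions (Young diagrams in $\mathbb{N}^2$). Then there is a bijection $\sigma\mapsto(\rho,\pi)$ between the set of skew plane partitions $\sigma$ of shape $(\lambda,\mu,\emptyset)$ and the set of pairs $(\rho,\pi)$ consisting of a reverse plane partition $\rho$ of shape $(\lambda,\mu,\emptyset)$ and a plane partition $\pi$, which is weight-preserving in the sense that $|\sigma| = |\rho| + |\pi|$.
   Context: $\mathbb{N}=\{1,2,\dots\}$, $\mathbb{N}_{\ge0}=\{0,1,2,\dots\}$. A partition is a weakly decreasing sequence $\lambda=(\lambda_1,\lambda_2,\dots)$ of nonnegative integers with finitely many nonzero terms; $|\lambda|=\sum_i\lambda_i$. A plane partition is a function $\pi:\mathbb{N}^2\to\mathbb{N}_{\ge0}$, weakly decreasing in each coordinate, with finitely many nonzero values; its weight $|\pi|$ is the sum of its entries. **Skew plane partitions.** An SPP of shape $(\lambda,\mu,\emptyset)$ is a function $\sigma:\mathbb{N}^2\to\mathbb{N}_{\ge0}$ with $\sigma(i,j)\ge\sigma(i+1,j)$ and $\sigma(i,j)\ge\sigma(i,j+1)$ for all $i,j$, such that $\sigma(i,j)\ge\max\{\lambda_j,\mu_i\}$ for all $i,j\in\mathbb{N}$, with strict inequality for only finitely many $(i,j)$. Its weight is $$|\sigma| = V_0(\lambda,\mu,\emptyset)+\sum_{i,j\in\mathbb{N}}\bigl(\sigma(i,j)-\max\{\lambda_j,\mu_i\}\bigr),$$ where $V_0(\lambda,\mu,\emptyset)$ is the minimal exponent of $q$ in the generating function $V_{(\lambda,\mu,\emptyset)}(q)=\langle\lambda|\cdots\Gamma_-(q^{3/2})\Gamma_-(q^{1/2})\Gamma_+(q^{1/2})\Gamma_+(q^{3/2})\cdots|\mu\rangle$,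 i.e. the weight of the minimal configuration. Explicitly: for an SPP $\sigma$ and $c\in\mathbb{Z}$ let $d_c(\sigma)$ be the (finite) sum of the entries $\sigma(i,j)$ with $j-i=c$. The exponent of $q$ contributed by $\sigma$ to this generating function is $$\sum_{c\ge0}\bigl(c+\tfrac12\bigr)\bigl(d_c(\sigma)-d_{c+1}(\sigma)\bigr)+\sum_{c\ge0}\bigl(c+\tfrac12\bigr)\bigl(d_{-c}(\sigma)-d_{-c-1}(\sigma)\bigr),$$ and $V_0(\lambda,\mu,\emptyset)$ is the minimum of this quantity over all SPPs of shape $(\lambda,\mu,\emptyset)$, attained at $\sigma(i,j)=\max\{\lambda_j,\mu_i\}$. **Reverse plane partitions.** Use the convention $\lambda_j=\infty$ for $j\le0$ and $\mu_i=\infty$ for $i\le0$. Let $D=(\mathbb{Z}\times\mathbb{N})\cup(\mathbb{N}\times\mathbb{Z})$. An RPP of shape $(\lambda,\mu,\emptyset)$ is a function $\rho:D\to\mathbb{N}_{\ge0}$ such that for all $(i,j)\in D$: (1) $\rho(i,j)\ge\max\{\rho(i+1,j),\rho(i,j+1)\}$; (2) $\rho(i,j)\le\min\{\lambda_j,\mu_i\}$, with strict inequality for only finitely many $(i,j)$. Its weight is $$|\rho|=W_0(\lambda,\mu,\emptyset)+\sum_{(i,j)\in D}\bigl(\min\{\lambda_j,\mu_i\}-\rho(i,j)\bigr),$$ where $W_0(\lambda,\mu,\emptyset)$ is the minimal exponent of $q$ in $W_{(\lambda,\mu,\emptyset)}(q)=\langle\mu|\cdots\Gamma_+(q^{3/2})\Gamma_+(q^{1/2})\Gamma_-(q^{1/2})\Gamma_-(q^{3/2})\cdots|\lambda\rangle$.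 Explicitly: for an RPP $\rho$ and $c\in\mathbb{Z}$ let $d_c(\rho)$ be the (finite) sum of the entries $\rho(i,j)$ with $(i,j)\in D$, $j-i=c$. The exponent contributed by $\rho$ is $$\sum_{c\ge0}\bigl(c+\tfrac12\bigr)\bigl(d_{c+1}(\rho)-d_c(\rho)\bigr)+\sum_{c\ge0}\bigl(c+\tfrac12\bigr)\bigl(d_{-c-1}(\rho)-d_{-c}(\rho)\bigr),$$ and $W_0(\lambda,\mu,\emptyset)$ is the minimum of this quantity over all RPPs of shape $(\lambda,\mu,\emptyset)$, attained at $\rho(i,j)=\min\{\lambda_j,\mu_i\}$. Here $\Gamma_+(x)|\lambda\rangle=\sum_{\mu\succ\lambda}x^{|\mu|-|\lambda|}|\mu\rangle$ and $\Gamma_-(x)|\lambda\rangle=\sum_{\mu\prec\lambda}x^{|\lambda|-|\mu|}|\mu\rangle$, where $\lambda\succ\mu$ means $\lambda_1\ge\mu_1\ge\lambda_2\ge\mu_2\ge\cdots$; the explicit exponents above are what these operators assign to the sequence of diagonals. *)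

(* Defs.v *)
From mathcomp Require Import all_boot all_order all_algebra.
From mathcomp Require Import boolp classical_sets functions cardinality fsbigop.

Set Implicit Arguments.
Unset Strict Implicit.
Unset Printing Implicit Defensive.

Import Order.TTheory GRing.Theory Num.Theory.

Local Open Scope classical_set_scope.
Local Open Scope ring_scope.

(* Conventions.  All indices are shifted down by one, so that {1, 2, ...}
   becomes nat: [lam j] is the part of index j + 1.  The difference j - i of
   the two coordinates of a cell is not affected by the shift.
   Weights are rational because the exponents are half-integers.
   A sum [\sum_(x \in A) F x] is the sum of the finitely many nonzero values
   of F on A; all the sums below have finite support on the sets of arrays
   where they are used. *)

Definition is_partition (lam : nat -> nat) : Prop :=
  (forall i, (lam i.+1 <= lam i)%N) /\ finite_set [set i | lam i != 0%N].

Definition plane_partition : set (nat -> nat -> nat) :=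
  [set p | [/\ forall i j, (p i.+1 j <= p i j)%N,
               forall i j, (p i j.+1 <= p i j)%N
             & finite_set [set x : nat * nat | p x.1 x.2 != 0%N]]].

Definition pp_weight (p : nat -> nat -> nat) : rat :=
  \sum_(x \in [set: nat * nat]) ((p x.1 x.2)%:R : rat).

(* The minimum of A, when A has one; 0 otherwise. *)
Definition minimum (A : set rat) : rat := xget 0 (A `&` lbound A).

Section Skew.
Variables lam mu : nat -> nat.

Definition spp_bound (i j : nat) : nat := maxn (lam j) (mu i).

Definition spp : set (nat -> nat -> nat) :=
  [set s | [/\ forall i j, (s i.+1 j <= s i j)%N,
               forall i j, (s i j.+1 <= s i j)%N,
               forall i j, (spp_bound i j <= s i j)%N
             & finite_set [set x : nat * nat | (spp_bound x.1 x.2 < s x.1 x.2)%N]]].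

Definition spp_diag (s : nat -> nat -> nat) (c : int) : rat :=
  \sum_(x \in [set x : nat * nat | x.2%:Z - x.1%:Z = c]) ((s x.1 x.2)%:R : rat).

Definition spp_exponent (s : nat -> nat -> nat) : rat :=
  \sum_(c \in [set: nat])
     (c%:R + 1 / 2) * (spp_diag s c%:Z - spp_diag s (c%:Z + 1))
  + \sum_(c \in [set: nat])
     (c%:R + 1 / 2) * (spp_diag s (- c%:Z) - spp_diag s (- c%:Z - 1)).

Definition V0 : rat := minimum [set spp_exponent s | s in spp].

Definition spp_weight (s : nat -> nat -> nat) : rat :=
  V0 + \sum_(x \in [set: nat * nat])
         ((s x.1 x.2)%:R - (spp_bound x.1 x.2)%:R : rat).

End Skew.

(* The set (Z x N) \cup (N x Z), with the shifted indices. *)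
Definition rpp_dom : Type := {x : int * int | (0 <= x.1) || (0 <= x.2)}.

Section Reverse.
Variables lam mu : nat -> nat.

(* min (lam j) (mu i), where lam j is infinite for j < 0 and mu i is infinite
   for i < 0.  The last case does not occur on [rpp_dom]. *)
Definition rpp_bound (x : int * int) : nat :=
  match x.1, x.2 with
  | Posz i, Posz j => minn (lam j) (mu i)
  | Negz _, Posz j => lam j
  | Posz i, Negz _ => mu i
  | Negz _, Negz _ => 0
  end.

Definition rpp : set (rpp_dom -> nat) :=
  [set r | [/\ forall x y : rpp_dom,
                 val y = ((val x).1 + 1, (val x).2) -> (r y <= r x)%N,
               forall x y : rpp_dom,
                 val y = ((val x).1, (val x).2 + 1) -> (r y <= r x)%N,
               forall x, (r x <= rpp_bound (val x))%N
             & finite_set [set x | (r x < rpp_bound (val x))%N]]].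

Definition rpp_diag (r : rpp_dom -> nat) (c : int) : rat :=
  \sum_(x \in [set x : rpp_dom | (val x).2 - (val x).1 = c]) ((r x)%:R : rat).

Definition rpp_exponent (r : rpp_dom -> nat) : rat :=
  \sum_(c \in [set: nat])
     (c%:R + 1 / 2) * (rpp_diag r (c%:Z + 1) - rpp_diag r c%:Z)
  + \sum_(c \in [set: nat])
     (c%:R + 1 / 2) * (rpp_diag r (- c%:Z - 1) - rpp_diag r (- c%:Z)).

Definition W0 : rat := minimum [set rpp_exponent r | r in rpp].

Definition rpp_weight (r : rpp_dom -> nat) : rat :=
  W0 + \sum_(x \in [set: rpp_dom]) ((rpp_bound (val x))%:R - (r x)%:R : rat).

End Reverse.

(* Main.v *)
(** Read along its diagonals, a skew plane partition is a bi-infinite path of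
    partitions from [lam] to [mu], each interlacing with the next, that grows up
    to the main diagonal and then shrinks; a reverse plane partition is such a
    path that first shrinks and then grows.  The two exponents are the same kind
    of weight: a step of label [(s, w)] costs [w] for each added box, and the
    labels of the second kind of path are those of the first in reverse order.
    Exchanging two consecutive labels only changes the partition [b] between the
    two steps, by reflecting each part in the interval that its neighbours allow;
    when a growing step moves past a shrinking one, the first part of [b] is
    unconstrained and its excess is a free natural number.  Hence reversing the
    labels multiplies the paths by a weighted set that does not depend on the
    endpoints.  For [lam = mu = 0] the paths are the plane partitions on one side
    and a single path on the other, so this set is in bijection with plane
    partitions.  A weight-[w] configuration is constant outside the diagonals
    [|c| < N] once [N >= w], so finitely many exchanges suffice at each weight. *)
Require Import Defs.
From mathcomp Require Import all_boot all_order all_algebra.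
From mathcomp Require Import boolp classical_sets functions cardinality fsbigop.
From mathcomp Require Import zify ring lra.

Set Implicit Arguments.
Unset Strict Implicit.
Unset Printing Implicit Defensive.

Import Order.TTheory GRing.Theory Num.Theory.

Local Open Scope classical_set_scope.
Local Open Scope ring_scope.

(** * Weight-preserving bijections *)

(** The maps are total on [T] and [U] but constrained only on [A] and [B]. Preservation of weight is
    asked of [f] alone, since the cancellation laws transfer it to [g]. *)
Definition weq T U (A : set T) (wA : T -> rat) (B : set U) (wB : U -> rat) :=
  exists (f : T -> U) (g : U -> T),
    [/\ forall a, A a -> B (f a) /\ g (f a) = a,
        forall b, B b -> A (g b) /\ f (g b) = b
      & forall a, A a -> wB (f a) = wA a].

Lemma weq_refl T (A : set T) w : weq A w A w.
Proof. by exists id, id. Qed.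

Lemma weq_sym T U (A : set T) wA (B : set U) wB : weq A wA B wB -> weq B wB A wA.
Proof.
move=> [f [g [fP gP wP]]]; exists g, f; split=> // b Bb.
by have [Agb fgb] := gP _ Bb; rewrite -{2}fgb wP.
Qed.

Lemma weq_trans T U V (B : set U) wB (A : set T) wA (C : set V) wC :
  weq A wA B wB -> weq B wB C wC -> weq A wA C wC.
Proof.
move=> [f [g [fP gP wP]]] [f' [g' [fP' gP' wP']]].
exists (f' \o f), (g \o g'); split=> /=.
- by move=> a /fP[/fP'[? ->] ->].
- by move=> c /gP'[/gP[? ->] ->].
- by move=> a Aa; have [Bfa _] := fP _ Aa; rewrite wP' // wP.
Qed.

Lemma eq_weq T U (A A' : set T) wA wA' (B B' : set U) wB wB' :
  A =1 A' -> (forall a, A a -> wA a = wA' a) ->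
  B =1 B' -> (forall b, B b -> wB b = wB' b) ->
  weq A wA B wB -> weq A' wA' B' wB'.
Proof.
move=> /funext<- eA /funext<- eB [f [g [fP gP wP]]]; exists f, g; split=> // a Aa.
by rewrite -eA // -wP // eB //; have [] := fP _ Aa.
Qed.

Definition pair_weight T U (wA : T -> rat) (wB : U -> rat) (x : T * U) : rat :=
  wA x.1 + wB x.2.

Lemma weq_prod T U T' U' (A : set T) wA (B : set U) wB (A' : set T') wA'
    (B' : set U') wB' :
  weq A wA A' wA' -> weq B wB B' wB' ->
  weq (A `*` B) (pair_weight wA wB) (A' `*` B') (pair_weight wA' wB').
Proof.
move=> [f [g [fP gP wP]]] [f' [g' [fP' gP' wP']]].
exists (fun x => (f x.1, f' x.2)), (fun x => (g x.1, g' x.2)).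
split=> -[a b] [/= Aa Bb].
- by have [? ->] := fP _ Aa; have [? ->] := fP' _ Bb.
- by have [? ->] := gP _ Aa; have [? ->] := gP' _ Bb.
- by rewrite /pair_weight /= wP // wP'.
Qed.

Lemma weq_prodA T U V (A : set T) wA (B : set U) wB (C : set V) wC :
  weq ((A `*` B) `*` C) (pair_weight (pair_weight wA wB) wC)
      (A `*` (B `*` C)) (pair_weight wA (pair_weight wB wC)).
Proof.
exists (fun x => (x.1.1, (x.1.2, x.2))), (fun x => ((x.1, x.2.1), x.2.2)).
split=> [[[a b] c] [[/= ? ?] ?]|[a [b c]] [/= ? [? ?]]|[[a b] c] [[/= ? ?] ?]] //.
by rewrite /pair_weight /= addrA.
Qed.

Lemma weq_set1l T U (x : T) (A : set T) wA (B : set U) wB :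
  A x -> (forall a, A a -> a = x) -> wA x = 0 ->
  weq (A `*` B) (pair_weight wA wB) B wB.
Proof.
move=> Ax Aeq wx; exists snd, (pair x); split=> [[a b] [/= /Aeq-> Bb]| |] //.
by move=> [a b] [/= /Aeq-> _]; rewrite /pair_weight /= wx add0r.
Qed.

(* The bijections are chosen separately for each value of the weight. *)
Lemma weq_glue T U (A : set T) wA (B : set U) wB :
  (forall w, exists A' B', [/\ A' `<=` A, B' `<=` B,
      forall a, A a -> wA a = w -> A' a, forall b, B b -> wB b = w -> B' b
    & weq A' wA B' wB]) ->
  weq A wA B wB.
Proof.
move=> H.
have {H} /choice[F FP] : forall w, exists fg : (T -> U) * (U -> T),
    [/\ forall a, A a -> wA a = w -> [/\ B (fg.1 a), fg.2 (fg.1 a) = a &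
          wB (fg.1 a) = w]
      & forall b, B b -> wB b = w -> [/\ A (fg.2 b), fg.1 (fg.2 b) = b &
          wA (fg.2 b) = w]].
  move=> w; have [A' [B' [A'A B'B AA' BB' AB]]] := H w.
  have [_ [_ [_ _ _]]] := weq_sym AB.
  have [f [g [fP gP wP]]] := AB.
  exists (f, g); split=> /= [a Aa wa|b Bb wb].
    have A'a := AA' _ Aa wa; have [/B'B Bfa gfa] := fP _ A'a.
    by split; rewrite ?wP.
  have B'b := BB' _ Bb wb; have [A'gb fgb] := gP _ B'b.
  by split; rewrite ?wP //; [exact: A'A|rewrite -wb -[in RHS]fgb wP].
(* The weight of the argument selects the bijection. As weights are preserved, the inverse map
   selects the same one. *)
exists (fun a => (F (wA a)).1 a), (fun b => (F (wB b)).2 b); split.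
- by move=> a Aa; have [+ _] := FP (wA a) => /(_ _ Aa erefl)[? ? ->].
- by move=> b Bb; have [_ +] := FP (wB b) => /(_ _ Bb erefl)[? ? ->].
- by move=> a Aa; have [+ _] := FP (wA a) => /(_ _ Aa erefl)[].
Qed.

(** * Interlacing partitions *)

(** An explicit bound on the support turns [psize] into a sum over ordinals and can be tracked along
    a path. *)
Definition vanish (L : nat) (a : nat -> nat) := forall k, (L <= k)%N -> a k = 0%N.

Lemma vanishW L L' a : (L <= L')%N -> vanish L a -> vanish L' a.
Proof. by move=> LL' H k /(leq_trans LL')/H. Qed.

Definition psize (a : nat -> nat) : rat := \sum_(k \in [set: nat]) ((a k)%:R : rat).

Lemma fsum_nat (F : nat -> rat) L : (forall k, (L <= k)%N -> F k = 0) ->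
  \sum_(k \in [set: nat]) F k = \sum_(k < L) F k.
Proof.
move=> FL; rewrite fsbig_ord; apply/esym/fsbig_widen => // k [_ /=].
by move=> /negP; rewrite -leqNgt => /FL.
Qed.

Lemma psizeE L a : vanish L a -> psize a = (\sum_(k < L) a k)%:R.
Proof. by move=> aL; rewrite natr_sum; apply: fsum_nat => k /aL ->. Qed.

(** The relation $b \succ a$, that is $b_0 \ge a_0 \ge b_1 \ge a_1 \ge \dots$. It makes both
    sequences weakly decreasing, and [interlace a a] says just that of [a]. *)
Definition interlace (a b : nat -> nat) :=
  forall i, (a i <= b i)%N /\ (b i.+1 <= a i)%N.

Definition step (s : bool) (a b : nat -> nat) :=
  if s then interlace a b else interlace b a.

Lemma step_vanish s L a b : step s a b -> vanish L a -> vanish L.+1 b.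
Proof.
move=> sab aL [//|k] Lk; case: s sab => sab.
  by have [_] := sab k; rewrite aL // leqn0 => /eqP.
by have [] := sab k.+1; rewrite aL ?leqn0; [move=> /eqP|lia].
Qed.

(** * Reflections of the partition between two steps *)

(** Summing the hypotheses pairs the maximum at index [i] with the minimum at [i.+1], both taken of
    [a i] and [d i.+1], and each pair adds up to [a i + d i.+1]. The one unpaired maximum is zero at
    the bound [L]. *)
Lemma reflect_same_weight L a d b b' : vanish L a -> vanish L d ->
  vanish L.+1 b -> vanish L.+1 b' ->
  (b 0 + b' 0 = maxn (a 0) (d 1) + d 0)%N ->
  (forall i, b i.+1 + b' i.+1 =
     maxn (a i.+1) (d i.+2) + minn (d i.+1) (a i))%N ->
  psize b = psize a + psize d - psize b'.
Proof.
move=> aL dL bL b'L e0 eS.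
rewrite (psizeE bL) (psizeE b'L) (psizeE (vanishW (leqnSn L) dL)) (psizeE aL).
suff H M : (\sum_(i < M.+1) b i + \sum_(i < M.+1) b' i =
            \sum_(i < M) a i + \sum_(i < M.+1) d i + maxn (a M) (d M.+1))%N.
  by apply/eqP; rewrite eq_sym subr_eq -!natrD H aL ?dL // addn0.
elim: M => [|M IH]; first by rewrite !big_ord1 big_ord0 /= e0; lia.
by move: IH (eS M); rewrite !big_ord_recr /=; lia.
Qed.

(** The same telescoping, with [b] and [b'] matched at a shift of one index; [k] is the excess of
    [b 0] over its lower bound. *)
Lemma reflect_opp_weight L a d b b' k : vanish L a -> vanish L d ->
  vanish L.+1 b -> vanish L b' ->
  (b 0 = k + maxn (a 0) (d 0))%N ->
  (forall i, b i.+1 + b' i =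
     maxn (a i.+1) (d i.+1) + minn (a i) (d i))%N ->
  psize b = psize a + psize d + k%:R - psize b'.
Proof.
move=> aL dL bL b'L e0 eS.
rewrite (psizeE bL) (psizeE b'L) (psizeE dL) (psizeE aL).
suff H M : (\sum_(i < M.+1) b i + \sum_(i < M) b' i =
            \sum_(i < M) a i + \sum_(i < M) d i + k + maxn (a M) (d M))%N.
  by apply/eqP; rewrite eq_sym subr_eq -!natrD H aL ?dL // addn0.
elim: M => [|M IH]; first by rewrite !big_ord1 !big_ord0 /= e0; lia.
by move: IH (eS M); rewrite !big_ord_recr /=; lia.
Qed.

(** The parts of [b] range independently over intervals read off from [a] and [d]. Reflecting every
    part in its interval is an involution that exchanges the two size increments. *)
Lemma toggle_same L a d : vanish L a -> vanish L d ->
  let S := [set b | interlace a b /\ interlace b d] in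
  weq S psize S (fun b => psize a + psize d - psize b).
Proof.
move=> aL dL S.
pose lo i := maxn (a i) (d i.+1).
(* No part of [a] bounds the first part of [b] from above. *)
pose hi i := if i is j.+1 then minn (d i) (a j) else d 0%N.
have SP b : S b <-> forall i, (lo i <= b i <= hi i)%N.
  rewrite /lo /hi; split=> [[ab bd] [|i]|H].
  - by have := ab 0%N; have := bd 0%N; lia.
  - by have := ab i.+1; have := bd i.+1; have := ab i; have := bd i; lia.
  - by split=> i; have := H i; have := H i.+1; case: i => [|i]; lia.
pose f (b : nat -> nat) i := (lo i + hi i - b i)%N.
have Sf b : S b -> S (f b).
  by move=> /SP Sb; apply/SP => i; rewrite /f; have := Sb i; lia.
have fK b : S b -> f (f b) = b.
  by move=> /SP Sb; apply/funext => i; rewrite /f; have := Sb i; lia.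
have Sv b : S b -> vanish L.+1 b.
  by move=> [ab _]; apply: (@step_vanish true _ _ _ ab).
exists f, f; split=> b Sb; rewrite ?fK //; try by split; [exact: Sf|].
apply/esym/(reflect_same_weight aL dL); try exact: Sv; first exact/Sv/Sf.
  by have /SP/(_ 0%N) := Sb; rewrite /f /lo /hi; lia.
by move=> i; have /SP/(_ i.+1) := Sb; rewrite /f /lo /hi; lia.
Qed.

(** The interval allowed to [b i.+1] on the left is the one allowed to part [i] on the right, so
    parts are reflected and shifted by one. The first part [b 0] has only a lower bound, and its
    excess becomes the second component. *)
Lemma toggle_opp L a d : vanish L a -> vanish L d ->
  weq [set b | interlace a b /\ interlace d b] psize
    ([set b | interlace b a /\ interlace b d] `*` [set: nat])
    (fun x => psize a + psize d + x.2%:R - psize x.1).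
Proof.
move=> aL dL.
pose r i x := (maxn (a i.+1) (d i.+1) + minn (a i) (d i) - x)%N.
pose f (b : nat -> nat) := (fun i => r i (b i.+1), (b 0 - maxn (a 0) (d 0))%N).
pose g (x : (nat -> nat) * nat) i :=
  if i is j.+1 then r j (x.1 j) else (x.2 + maxn (a 0) (d 0))%N.
have fS b : interlace a b -> interlace d b ->
    interlace (f b).1 a /\ interlace (f b).1 d.
  move=> ab db; split=> i; rewrite /f /r /=;
  by have := ab i; have := db i; have := ab i.+1; have := db i.+1; lia.
exists f, g; split.
- move=> b [ab db]; split; first by split=> //; exact: fS.
  apply/funext => -[|i]; rewrite /g /f /r /=.
    by have := ab 0%N; have := db 0%N; lia.
  by have := ab i; have := db i; have := ab i.+1; have := db i.+1; lia.
- move=> [b k] [/= [ba bd] _]; split.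
    split=> -[|i]; rewrite /g /r /=.
    + by have := ba 0%N; have := bd 0%N; lia.
    + by have := ba i; have := bd i; have := ba i.+1; have := bd i.+1; lia.
    + by have := ba 0%N; have := bd 0%N; lia.
    + by have := ba i; have := bd i; have := ba i.+1; have := bd i.+1; lia.
  congr pair; last by rewrite /g /=; lia.
  by apply/funext => i; rewrite /g /r /=; have := ba i; have := bd i; lia.
- move=> b [ab db]; rewrite /= -/(f b).1 -/(f b).2.
  have [fa _] := fS b ab db.
  apply/esym/eqP; rewrite eq_sym subr_eq; apply/eqP; rewrite addrC.
  have bL : vanish L.+1 b by exact: (@step_vanish true _ _ _ ab).
  have fL : vanish L (f b).1 by move=> i Li; have := fa i; rewrite aL //; lia.
  rewrite (@reflect_opp_weight L a d b (f b).1 (f b).2) //; first by ring.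
    by have := ab 0%N; have := db 0%N; rewrite /f /=; lia.
  by move=> i; have := ab i; have := db i; have := ab i.+1; have := db i.+1;
    rewrite /f /r /=; lia.
Qed.

Lemma weq_zero T (A : set T) wA (wB : T * nat -> rat) (p : pred nat) :
  (forall k, p k = (k == 0)%N) -> (forall a, wB (a, 0%N) = wA a) ->
  weq A wA (A `*` [set k | p k]) wB.
Proof.
move=> pE wE; exists (fun a => (a, 0%N)), fst; split=> //= [a Aa|[a k] [/= Aa]].
  by rewrite pE.
by rewrite pE => /eqP->.
Qed.

(** The condition [s1 || ~~ s2] excludes a shrinking step followed by a growing one. The exponent is
    free when a growing step precedes a shrinking one, and is forced to be 0 otherwise. *)
Lemma toggle s1 s2 L a d : vanish L a -> vanish L d -> s1 || ~~ s2 ->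
  weq [set b | step s1 a b /\ step s2 b d] psize
    ([set b | step s2 a b /\ step s1 b d] `*`
       [set k | s1 && ~~ s2 || (k == 0%N)])
    (fun x => psize a + psize d + x.2%:R - psize x.1).
Proof.
move=> aL dL; case: s1 s2 => -[] //= _.
- apply: weq_trans (toggle_same aL dL) _; apply: weq_zero => //= b.
  by rewrite addr0.
- rewrite (_ : [set k : nat | _] = setT); first exact: toggle_opp aL dL.
  by apply/seteqP; split.
- rewrite (_ : [set b | _] = [set b | interlace d b /\ interlace b a]); last first.
    by apply/seteqP; split=> b [].
  apply: weq_trans (toggle_same dL aL) _; apply: weq_zero => //= b.
  by rewrite addr0 [psize d + _]addrC.
Qed.

(** * Paths of interlacing partitions *)

(** Chooses bijections for all parameters at once, so that they can be applied fibrewise to paths.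
    The points [t0] and [u0] provide constant maps outside [D]. *)
Lemma weq_choice I (D : set I) T U (t0 : T) (u0 : U) (A : I -> set T) wA
    (B : I -> set U) wB :
  (forall i, D i -> weq (A i) (wA i) (B i) (wB i)) ->
  exists (f : I -> T -> U) (g : I -> U -> T), forall i, D i ->
    [/\ forall a, A i a -> B i (f i a) /\ g i (f i a) = a,
        forall b, B i b -> A i (g i b) /\ f i (g i b) = b
      & forall a, A i a -> wB i (f i a) = wA i a].
Proof.
move=> H.
have [|F FP] := choice (P := fun i (fg : (T -> U) * (U -> T)) => D i ->
    [/\ forall a, A i a -> B i (fg.1 a) /\ fg.2 (fg.1 a) = a,
        forall b, B i b -> A i (fg.2 b) /\ fg.1 (fg.2 b) = b
      & forall a, A i a -> wB i (fg.1 a) = wA i a]) _.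
  move=> i; have [/H[f [g fgP]]|nDi] := pselect (D i); first by exists (f, g).
  by exists (fun=> u0, fun=> t0).
by exists (fun i => (F i).1), (fun i => (F i).2).
Qed.

(* A label [(s, w)] is a step of sign [s] on which each added box weighs [w]. *)
Fixpoint path_ok (z a : nat -> nat) (ls : seq (bool * rat)) p : Prop :=
  match ls, p with
  | [::], [::] => a = z
  | l :: ls, b :: p => step l.1 a b /\ path_ok z b ls p
  | _, _ => False
  end.

Fixpoint path_weight (a : nat -> nat) (ls : seq (bool * rat)) p : rat :=
  match ls, p with
  | l :: ls, b :: p => l.2 * (psize b - psize a) + path_weight b ls p
  | _, _ => 0
  end.

Definition paths ls a z : set (seq (nat -> nat)) := [set p | path_ok z a ls p].

(** Fibres over the vertex [b] reached by the first step: the bijection for the tails keeps [b], and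
    the first step has the same weight on both sides. This works because [C] does not depend on
    [b]. *)
Lemma paths_cons l ls ls' z (M : pointedType) (C : set M) wC :
  (forall L b, vanish L b ->
     weq (paths ls b z) (path_weight b ls)
         (paths ls' b z `*` C) (pair_weight (path_weight b ls') wC)) ->
  forall L a, vanish L a ->
     weq (paths (l :: ls) a z) (path_weight a (l :: ls))
         (paths (l :: ls') a z `*` C) (pair_weight (path_weight a (l :: ls')) wC).
Proof.
move=> H L a aL.
have [|f [g fgP]] := weq_choice (D := vanish L.+1) [::] ([::], point)
  (A := fun b => paths ls b z) (wA := fun b => path_weight b ls)
  (B := fun b => paths ls' b z `*` C)
  (wB := fun b => pair_weight (path_weight b ls') wC) _.
  by move=> b /H.
exists (fun p => let b := head a p in
  (b :: (f b (behead p)).1, (f b (behead p)).2)).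
exists (fun x => let b := head a x.1 in b :: g b (behead x.1, x.2)).
split.
- move=> [//|b p] [/= ab bp].
  have [fP _ _] := fgP b (step_vanish ab aL).
  by have [[? ?] e] := fP _ bp; rewrite -surjective_pairing e.
- move=> [[|b p] m] [] //= [ab bp] Cm.
  have [_ gP _] := fgP b (step_vanish ab aL).
  by have [? ->] := gP (p, m) (conj bp Cm).
- move=> [//|b p] [/= ab bp].
  have [_ _ wP] := fgP b (step_vanish ab aL).
  by rewrite -(wP _ bp) /pair_weight /= addrA.
Qed.

(** With weight [k%:R * (l1.2 - l2.2)], its generating function for a growing [l1] and a shrinking
    [l2] is the factor $1/(1-q^{w_1-w_2})$ from the commutation of two vertex operators; in all
    other cases it is 1. *)
Definition swap_exponents (l1 l2 : bool * rat) : set nat :=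
  [set k | l1.1 && ~~ l2.1 || (k == 0%N)].

(** Applies [toggle] to the vertex [b] between [a] and the fixed next vertex [d]. Substituting $|b|
    = |a| + |d| + k - |b'|$ in the weight exchanges the two labels and leaves $k (w_1 - w_2)$. *)
Lemma paths_swap l1 l2 ls z L a : vanish L a -> l1.1 || ~~ l2.1 ->
  weq (paths (l1 :: l2 :: ls) a z) (path_weight a (l1 :: l2 :: ls))
      (paths (l2 :: l1 :: ls) a z `*` swap_exponents l1 l2)
      (pair_weight (path_weight a (l2 :: l1 :: ls))
                   (fun k => k%:R * (l1.2 - l2.2))).
Proof.
move=> aL l12.
have [|f [g fgP]] := weq_choice (D := vanish L.+2) a (a, 0%N)
  (A := fun d => [set b | step l1.1 a b /\ step l2.1 b d]) (wA := fun=> psize)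
  (B := fun d => [set b | step l2.1 a b /\ step l1.1 b d] `*` swap_exponents l1 l2)
  (wB := fun d x => psize a + psize d + x.2%:R - psize x.1) _.
  by move=> d dL; apply: (@toggle _ _ L.+2) => //; apply: vanishW aL; lia.
pose F (p : seq (nat -> nat)) := if p is b :: d :: p' then
  ((f d b).1 :: d :: p', (f d b).2) else (p, 0%N).
pose G (x : seq (nat -> nat) * nat) := if x.1 is b :: d :: p' then
  g d (b, x.2) :: d :: p' else x.1.
exists F, G; split.
- move=> [|b [|d p]] [] //= ab [bd dp].
  have [fP _ _] := fgP d (step_vanish bd (step_vanish ab aL)).
  by have [[[? ?] ?] e] := fP b (conj ab bd); rewrite /G /= -surjective_pairing e.
- move=> [[|b [|d p]] k] [] //= [ab] // [bd dp] kP.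
  have [_ gP _] := fgP d (step_vanish bd (step_vanish ab aL)).
  by have [[? ?] e] := gP (b, k) (conj (conj ab bd) kP); rewrite /F /G /= e.
- move=> [|b [|d p]] [] //= ab [bd dp].
  have [_ _ wP] := fgP d (step_vanish bd (step_vanish ab aL)).
  have := wP b (conj ab bd); rewrite /F /pair_weight /= => {1 2}<-.
  ring.
Qed.

(** Moves [l] to the end by successive exchanges, collecting their exponents. The order of the
    quantifiers matters: [C] and [wC] are fixed before the endpoints, so they depend on the labels
    alone. *)
Lemma paths_rot l ls : l.1 || all (fun x => ~~ x.1) ls ->
  exists (M : pointedType) (C : set M) wC, forall z L a, vanish L a ->
    weq (paths (l :: ls) a z) (path_weight a (l :: ls))
        (paths (rcons ls l) a z `*` C)
        (pair_weight (path_weight a (rcons ls l)) wC).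
Proof.
elim: ls => [_|l' ls IH l_ls].
  exists unit, setT, (fun=> 0) => z L a _.
  exists (pair^~ tt), fst; split=> [p ?|[p []] [? _]|p _] //.
  by rewrite /pair_weight /= addr0.
have [|M [C [wC H]]] := IH.
  by move: l_ls => /= /orP[->|/andP[_ ->]]; rewrite ?orbT.
exists (M * nat)%type, (C `*` swap_exponents l l').
exists (pair_weight wC (fun k => k%:R * (l.2 - l'.2))) => z L a aL.
have l_l' : l.1 || ~~ l'.1.
  by move: l_ls => /= /orP[->|/andP[-> _]]; rewrite ?orbT.
(* First [l] passes [l']; then, with [l'] as first step, it passes the remaining labels by
   induction. *)
apply: weq_trans (paths_swap _ _ aL l_l') _.
apply: weq_trans (weq_prodA _ _ _ _ _ _).
apply: weq_prod (weq_refl _ _).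
by apply: paths_cons aL => L' b; apply: H.
Qed.

(** The tail is reversed first, then the head is moved to the end. Sortedness puts growing labels
    before shrinking ones, so the exchange excluded in [toggle] never occurs. *)
Lemma paths_rev ls : sorted (fun l1 l2 : bool * rat => l1.1 || ~~ l2.1) ls ->
  exists (M : pointedType) (C : set M) wC, forall z L a, vanish L a ->
    weq (paths ls a z) (path_weight a ls)
        (paths (rev ls) a z `*` C) (pair_weight (path_weight a (rev ls)) wC).
Proof.
elim: ls => [_|l ls IH l_ls].
  exists unit, setT, (fun=> 0) => z L a _.
  by exists (pair^~ tt), fst; split=> [p ?|[p []] [? _]|p _].
have [M [C [wC H]]] := IH (path_sorted l_ls).
have [|M' [C' [wC' H']]] := @paths_rot l (rev ls).
  have : all (fun l' => l.1 || ~~ l'.1) ls.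
    by apply: order_path_min l_ls => -[[] ?] [[] ?] [[] ?].
  by case: l.1 => //= ?; rewrite all_rev.
exists (M' * M)%type, (C' `*` C), (pair_weight wC' wC) => z L a aL.
have /(_ L a aL) := @paths_cons l ls (rev ls) z M C wC (fun L' b => H z L' b).
move=> /weq_trans; apply.
rewrite rev_cons; apply: weq_trans (weq_prodA _ _ _ _ _ _).
by apply: weq_prod (weq_refl _ _); exact: H' aL.
Qed.

(** Indexed form of the recursion, to be matched with diagonals numbered by integers. *)
Lemma path_okE z a ls p : path_ok z a ls p <->
  [/\ size p = size ls, last a p = z & forall t, (t < size ls)%N ->
      step (nth (true, 0) ls t).1 (nth z (a :: p) t) (nth z p t)].
Proof.
elim: ls p a => [|l ls IH] [|b p] a /=; split=> //; try by case.
- by move=> [ab /IH[-> <- H]]; split=> // -[|t] //; exact: H.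
- move=> [[sp] bz H]; split; first exact: (H 0%N).
  by apply/IH; split=> // t; exact: (H t.+1).
Qed.

Lemma path_weightE z a ls p : size p = size ls -> path_weight a ls p =
  \sum_(t < size ls) (nth (true, 0) ls t).2 *
    (psize (nth z p t) - psize (nth z (a :: p) t)).
Proof.
elim: ls p a => [|l ls IH] [|b p] a //= => [_|[sp]]; first by rewrite big_ord0.
by rewrite big_ord_recl /= IH.
Qed.

(** * Families of diagonals *)

Definition sgn (b : bool) : rat := if b then 1 else -1.

(** The value [true] stands for skew plane partitions, which grow up to diagonal 0, and [false] for
    reverse plane partitions, which shrink up to it. *)
Definition fam_steps b (k : int -> nat -> nat) :=
  forall c : int, step (if c < 0 then b else ~~ b) (k c) (k (c + 1)).

Definition fam_lim N lam mu (k : int -> nat -> nat) :=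
  forall c : int, (N%:Z <= c -> k c = mu) /\ (c <= - N%:Z -> k c = lam).

Definition famN N b lam mu := [set k | fam_steps b k /\ fam_lim N lam mu k].

Definition fam b lam mu := [set k | fam_steps b k /\ exists N, fam_lim N lam mu k].

Definition fam_exponent (k : int -> nat -> nat) : rat :=
  \sum_(c \in [set: nat])
     (c%:R + 1 / 2) * (psize (k c%:Z) - psize (k (c%:Z + 1)))
  + \sum_(c \in [set: nat])
     (c%:R + 1 / 2) * (psize (k (- c%:Z)) - psize (k (- c%:Z - 1))).

Definition fam_weight b k := sgn b * fam_exponent k.

Lemma fam_limW N N' lam mu k : (N <= N')%N -> fam_lim N lam mu k -> fam_lim N' lam mu k.
Proof. by move=> NN' H c; have [H1 H2] := H c; split=> ?; [apply: H1|apply: H2]; lia. Qed.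

Lemma fam_exponentE N lam mu k : fam_lim N lam mu k -> fam_exponent k =
  \sum_(c < N) (c%:R + 1 / 2) * (psize (k c%:Z) - psize (k (c%:Z + 1))) +
  \sum_(c < N) (c%:R + 1 / 2) * (psize (k (- c%:Z)) - psize (k (- c%:Z - 1))).
Proof.
move=> kN; congr (_ + _); apply: fsum_nat => c Nc.
  by rewrite (kN _).1 ?(kN (_ + _)).1 ?subrr ?mulr0 //; lia.
by rewrite (kN (- _)).2 ?(kN (_ - _)).2 ?subrr ?mulr0 //; lia.
Qed.

(** Merges the two half sums: the step from [c] to [c + 1], with [c = t - N], has coefficient $-(c +
    1/2)$ on either side of the main diagonal. *)
Lemma fam_exponent_steps N lam mu k : fam_lim N lam mu k -> fam_exponent k =
  \sum_(t < N + N) (N%:R - t%:R - 1 / 2) *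
     (psize (k (t%:Z + 1 - N%:Z)) - psize (k (t%:Z - N%:Z))).
Proof.
move=> /fam_exponentE->; rewrite big_split_ord /= [LHS]addrC; congr (_ + _).
  rewrite (reindex_inj rev_ord_inj) /=; apply: eq_bigr => t _.
  rewrite (_ : - (N - t.+1)%N%:Z = t%:Z + 1 - N%:Z); last by have := ltn_ord t; lia.
  rewrite (_ : t%:Z + 1 - N%:Z - 1 = t%:Z - N%:Z); last lia.
  by rewrite natrB ?ltn_ord //; congr (_ * _); rewrite -[t.+1]addn1 natrD; field.
apply: eq_bigr => t _.
rewrite (_ : (N + t)%N%:Z + 1 - N%:Z = t%:Z + 1); last lia.
rewrite (_ : (N + t)%N%:Z - N%:Z = t%:Z); last lia.
by rewrite natrD; ring.
Qed.

Definition labels N b : seq (bool * rat) :=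
  mkseq (fun t => (if (t < N)%N then b else ~~ b,
                   sgn b * (N%:R - t%:R - 1 / 2))) (N + N).

(** The substitution $t \mapsto 2N - 1 - t$ exchanges the two halves and negates $N - t - 1/2$,
    which is the effect of changing [b]. *)
Lemma rev_labels N : rev (labels N true) = labels N false.
Proof.
apply: (@eq_from_nth _ (true, 0)) => [|t]; rewrite size_rev !size_mkseq // => tN.
rewrite nth_rev size_mkseq // !nth_mkseq //; last lia.
congr pair; last by rewrite /sgn natrB // natrD -[t.+1]addn1 natrD; field.
by case: ltnP => ?; case: ltnP => ? //; exfalso; lia.
Qed.

Lemma sorted_labels N :
  sorted (fun l1 l2 : bool * rat => l1.1 || ~~ l2.1) (labels N true).
Proof.
rewrite /labels /mkseq sorted_map; apply: sub_sorted (iota_ltn_sorted 0 (N + N)).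
by move=> t t' /= tt'; case: ltnP => ?; case: ltnP => ? //; exfalso; lia.
Qed.

(** The path records the diagonals from [- N] to [N]. Outside this window the family is constant,
    and constant steps are legal because [lam] and [mu] are weakly decreasing. *)
Lemma famN_paths N b lam mu : interlace lam lam -> interlace mu mu ->
  weq (famN N b lam mu) (fam_weight b)
      (paths (labels N b) lam mu) (path_weight lam (labels N b)).
Proof.
move=> lamI muI.
(* The diagonal at [- N], equal to [lam], is the starting point and is not listed. *)
pose f (k : int -> nat -> nat) := mkseq (fun t => k (t%:Z + 1 - N%:Z)) (N + N).
(* To the left of the window the value is [lam]; to the right, [nth] returns its default [mu]. *)
pose g p (c : int) : nat -> nat :=
  if c + N%:Z is Posz t then nth mu (lam :: p) t else lam.
have gE p t : g p (t%:Z - N%:Z) = nth mu (lam :: p) t by rewrite /g subrK.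
have gS p t : g p (t%:Z + 1 - N%:Z) = nth mu p t.
  by rewrite (_ : t%:Z + 1 = t.+1%:Z) ?gE //; lia.
have fE k t : fam_lim N lam mu k -> (t < (N + N).+1)%N ->
    nth mu (lam :: f k) t = k (t%:Z - N%:Z).
  move=> kN; case: t => [_|t tN] /=; first by rewrite (kN _).2 //; lia.
  by rewrite nth_mkseq //; congr k; lia.
have fg p : size p = (N + N)%N -> f (g p) = p.
  move=> sp; apply: (@eq_from_nth _ mu); rewrite size_mkseq // => t tN.
  by rewrite nth_mkseq // gS.
have g_lim p : size p = (N + N)%N -> last lam p = mu -> fam_lim N lam mu (g p).
  move=> sp pmu c; split=> cN.
    rewrite (_ : c = (absz (c + N%:Z))%:Z - N%:Z); last lia.
    rewrite gE; case: (ltngtP (absz (c + N%:Z)) (N + N)) => [|?|->]; first lia.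
      by rewrite nth_default //= sp; lia.
    by rewrite -sp -last_nth.
  rewrite /g; case E: (c + N%:Z) => [[|t]|t] //; lia.
exists f, g; split.
- move=> k [kS kN]; split; last first.
    apply/funext => c; rewrite /g; case E: (c + N%:Z) => [t|t]; last first.
      by rewrite (kN c).2 //; lia.
    case: (ltnP t (N + N).+1) => tN; first by rewrite fE //; congr k; lia.
    by rewrite nth_default ?(kN c).1 //= ?size_mkseq; lia.
  apply/path_okE; rewrite !size_mkseq; split=> //.
    by rewrite (last_nth mu) size_mkseq fE // (kN _).1 //; lia.
  move=> t tN; rewrite fE ?nth_mkseq //=; last lia.
  have := kS (t%:Z - N%:Z); rewrite (_ : t%:Z - N%:Z + 1 = t%:Z + 1 - N%:Z); last lia.
  by rewrite (_ : (t%:Z - N%:Z < 0) = (t < N)%N) //; lia.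
- move=> p /path_okE; rewrite size_mkseq => -[sp pmu pS].
  split; last exact: fg.
  split; last exact: g_lim.
  move=> c; have gN := g_lim p sp pmu.
  have [cN|cN] := lerP N%:Z c.
    rewrite (gN c).1 ?(gN (c + 1)).1 //; try lia.
    by case: ifP => _; case: b {pS} => /=.
  have [cN'|cN'] := ltrP c (- N%:Z).
    rewrite (gN c).2 ?(gN (c + 1)).2 //; try lia.
    by case: ifP => _; case: b {pS} => /=.
  have [t ct] : exists t : nat, c = t%:Z - N%:Z.
    by exists (absz (c + N%:Z)); lia.
  have := pS t; rewrite nth_mkseq ?ct /=; last lia.
  rewrite (_ : t%:Z - N%:Z + 1 = t%:Z + 1 - N%:Z); last lia.
  rewrite gE gS (_ : (t%:Z - N%:Z < 0) = (t < N)%N); last lia.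
  by apply; lia.
- move=> k [kS kN].
  rewrite (path_weightE mu) ?size_mkseq // /fam_weight (fam_exponent_steps kN).
  rewrite mulr_sumr; apply: eq_bigr => t _; have tN := ltn_ord t.
  by rewrite fE ?nth_mkseq //=; [ring|lia].
Qed.

(** * Bounding the support of a family by its weight *)

Lemma fam_vanish b lam mu k L : fam b lam mu k -> vanish L lam ->
  exists L', forall c, vanish L' (k c).
Proof.
move=> [kS [N kN]] lamL.
have kt t : vanish (L + t) (k (t%:Z - N%:Z)).
  elim: t => [|t IH]; first by rewrite addn0 (kN _).2 //; lia.
  have := step_vanish (kS _) IH.
  by rewrite addnS (_ : t%:Z - N%:Z + 1 = t.+1%:Z - N%:Z) //; lia.
exists (L + (N + N))%N => c.
have [cN|cN] := lerP N%:Z c.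
  have := kt (N + N)%N; rewrite (kN _).1 ?(kN c).1 //; lia.
have [cN'|cN'] := lerP c (- N%:Z).
  by rewrite (kN c).2 //; apply: vanishW lamL; lia.
rewrite (_ : c = (absz (c + N%:Z))%:Z - N%:Z); last lia.
by apply: vanishW (kt _); lia.
Qed.

Lemma psize_le L a b : vanish L b -> (forall i, (a i <= b i)%N) -> psize a <= psize b.
Proof.
move=> bL ab; rewrite (@psizeE L) ?(psizeE bL); first by rewrite ler_nat leq_sum.
by move=> i /bL bi; have := ab i; rewrite bi; lia.
Qed.

Lemma psize_lt L a b : vanish L b -> (forall i, (a i <= b i)%N) -> a != b ->
  psize a + 1 <= psize b.
Proof.
move=> bL ab /eqP ne; have [[i abi]|H] := pselect (exists i, (a i < b i)%N).
  have iL : (i < L)%N by rewrite ltnNge; apply/negP => /bL; lia.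
  have aL : vanish L a by move=> j /bL bj; have := ab j; rewrite bj; lia.
  rewrite (psizeE aL) (psizeE bL) natr1 ler_nat.
  rewrite (bigD1 (Ordinal iL)) //= [leqRHS](bigD1 (Ordinal iL)) //= -addSn.
  by apply: leq_add => //; apply: leq_sum.
exfalso; apply: ne; apply/funext => i; apply/eqP; rewrite eqn_leq ab leqNgt.
by apply/negP => ?; apply: H; exists i.
Qed.

Lemma step_psize s L a b : step s a b -> vanish L a -> vanish L b ->
  0 <= sgn s * (psize b - psize a) /\
  (b != a -> 1 <= sgn s * (psize b - psize a)).
Proof.
move=> sab aL bL; case: s sab => ab.
  have {}ab i : (a i <= b i)%N by have [] := ab i.
  rewrite mul1r subr_ge0 (psize_le bL ab); split=> //.
  by rewrite eq_sym => /(psize_lt bL ab); lra.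
have {}ab i : (b i <= a i)%N by have [] := ab i.
rewrite mulN1r opprB subr_ge0 (psize_le aL ab); split=> //.
by move=> /(psize_lt aL ab); lra.
Qed.

(** The direction of each step agrees with the sign of its coefficient, so no term is negative, and
    a nontrivial step changes the size by at least 1. *)
Lemma fam_term_ge b lam mu k L (c : int) : fam b lam mu k -> vanish L lam ->
  let w := - sgn b * (c%:~R + 1 / 2) * (psize (k (c + 1)) - psize (k c)) in
  0 <= w /\ (k (c + 1) != k c -> `|c%:~R + 1 / 2| <= w).
Proof.
move=> kF lamL; have [L' kL] := fam_vanish kF lamL; case: kF => kS _.
have [e0 e1] := step_psize (kS c) (kL c) (kL (c + 1)).
(* For an integer [c], $c + 1/2$ is negative exactly when [c < 0], the case distinction of
   [fam_steps]. *)
have -> : - sgn b * (c%:~R + 1 / 2) =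
    `|c%:~R + 1 / 2| * sgn (if c < 0 then b else ~~ b).
  case: ltrP => c0.
    have cr : c%:~R <= -1 :> rat by rewrite (ler_int _ c (-1)); lia.
    by rewrite ler0_norm; [ring|lra].
  have cr : 0 <= c%:~R :> rat by rewrite ler0z.
  rewrite ger0_norm; last lra.
  by case: b {kS e0 e1} => /=; rewrite /sgn; ring.
rewrite /= -mulrA; split; first by rewrite mulr_ge0.
by move=> /e1 H; rewrite ler_peMr.
Qed.

Lemma fam_weight_ge b lam mu k L : fam b lam mu k -> vanish L lam ->
  0 <= fam_weight b k /\
  forall c : int, k (c + 1) != k c -> `|c%:~R + 1 / 2| <= fam_weight b k.
Proof.
move=> kF lamL; have [_ [N kN]] := kF.
have kE : fam_weight b k = \sum_(t < N + N)
    - sgn b * ((t%:Z - N%:Z)%:~R + 1 / 2) *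
      (psize (k (t%:Z - N%:Z + 1)) - psize (k (t%:Z - N%:Z))).
  rewrite /fam_weight (fam_exponent_steps kN) mulr_sumr; apply: eq_bigr => t _.
  rewrite (_ : t%:Z - N%:Z + 1 = t%:Z + 1 - N%:Z); last lia.
  by rewrite rmorphB /=; field.
split; first by rewrite kE sumr_ge0 // => t _; have [] := fam_term_ge (t%:Z - N%:Z) kF lamL.
move=> c kc.
have [cN|cN] := lerP N%:Z c.
  by case/eqP: kc; rewrite (kN c).1 ?(kN (c + 1)).1 //; lia.
have [cN'|cN'] := ltrP c (- N%:Z).
  by case/eqP: kc; rewrite (kN c).2 ?(kN (c + 1)).2 //; lia.
have tN : (absz (c + N%:Z)%R < N + N)%N by lia.
have [_ /(_ kc)/le_trans] := fam_term_ge c kF lamL; apply.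
rewrite kE (bigD1 (Ordinal tN)) //= (_ : (absz (c + N%:Z))%:Z - N%:Z = c); last lia.
by rewrite lerDl sumr_ge0 // => t _; have [] := fam_term_ge (t%:Z - N%:Z) kF lamL.
Qed.

(** Nontrivial steps at [c >= N] or [c < - N] would cost more than [N]. The window thus depends on
    the weight alone, which allows passing to finite paths. *)
Lemma fam_lim_of_weight b lam mu k L N : fam b lam mu k -> vanish L lam ->
  fam_weight b k <= N%:R -> famN N b lam mu k.
Proof.
move=> kF lamL kw; have [kS [N' kN']] := kF; split=> //.
have [_ kge] := fam_weight_ge kF lamL.
have kc (c : int) : N%:R < `|c%:~R + 1 / 2 : rat| -> k (c + 1) = k c.
  move=> cN; apply/eqP; apply/negPn/negP => /kge.
  by rewrite leNgt (le_lt_trans kw).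
have normR (c : int) : N%:Z <= c -> N%:R < `|c%:~R + 1 / 2 : rat|.
  move=> cN; have : (N%:Z)%:~R <= c%:~R :> rat by rewrite ler_int.
  by move=> ?; rewrite lter_normr; apply/orP; left; lra.
have normL (c : int) : c < - N%:Z -> N%:R < `|c%:~R + 1 / 2 : rat|.
  move=> cN; have : (c + 1)%:~R <= (- N%:Z)%:~R :> rat by rewrite ler_int; lia.
  rewrite rmorphD rmorphN /= => ?.
  by rewrite lter_normr; apply/orP; right; lra.
(* Trivial steps carry the value out to the unknown bound [N'], where the limits hold. *)
have right (m : nat) (c : int) : N%:Z <= c -> k (c + m%:Z) = k c.
  move=> cN; elim: m => [|m IH]; first by rewrite addr0.
  by rewrite (_ : c + m.+1%:Z = c + m%:Z + 1) ?kc ?normR //; lia.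
have left (m : nat) (c : int) : c <= - N%:Z -> k (c - m%:Z) = k c.
  move=> cN; elim: m => [|m IH]; first by rewrite subr0.
  by rewrite -IH (_ : c - m%:Z = c - m.+1%:Z + 1) ?kc ?normL //; lia.
move=> c; split=> cN.
  by rewrite -(right N') // (kN' _).1 //; lia.
by rewrite -(left N') // (kN' _).2 //; lia.
Qed.

(** Such a family shrinks from [lam] and then grows to [mu]; with both endpoints zero it must
    therefore be zero. *)
Lemma fam_false_le lam mu k (c : int) i : fam false lam mu k ->
  (c <= 0 -> (k c i <= lam i)%N) /\ (0 <= c -> (k c i <= mu i)%N).
Proof.
move=> [kS [N kN]]; split=> c0.
  have H (m : nat) : (k c i <= k (c - m%:Z)%R i)%N.
    elim: m => [|m IH]; first by rewrite subr0.
    apply: leq_trans IH _; have := kS (c - m.+1%:Z).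
    rewrite (_ : c - m.+1%:Z + 1 = c - m%:Z); last lia.
    by rewrite ifT; [case/(_ i)|lia].
  by have := H N; rewrite (kN (c - _)).2 //; lia.
have H (m : nat) : (k c i <= k (c + m%:Z)%R i)%N.
  elim: m => [|m IH]; first by rewrite addr0.
  apply: leq_trans IH _; have := kS (c + m%:Z).
  rewrite (_ : c + m%:Z + 1 = c + m.+1%:Z); last lia.
  by rewrite ifF; [case/(_ i)|lia].
by have := H N; rewrite (kN (c + _)).1 //; lia.
Qed.

(** The factor [C] of [paths_rev] is used twice in the same window: with endpoints [lam] and [mu],
    and with zero endpoints, where it is identified. *)
Lemma fam_commute lam mu L : interlace lam lam -> interlace mu mu -> vanish L lam ->
  weq (fam true lam mu) (fam_weight true)
      (fam false lam mu `*` fam true (fun=> 0%N) (fun=> 0%N))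
      (pair_weight (fam_weight false) (fam_weight true)).
Proof.
move=> lamI muI lamL; set z : nat -> nat := fun=> 0%N.
have zI : interlace z z by [].
have zL : vanish 0 z by [].
have fam_z k : fam false z z k -> k = fun=> z.
  move=> kF; apply/funext => c; apply/funext => i.
  have [H1 H2] := fam_false_le c i kF; rewrite /z in H1 H2 *.
  by case: (lerP c 0) => [/H1|/ltW/H2]; rewrite leqn0 => /eqP.
have z_weight : fam_weight false (fun=> z) = 0.
  by rewrite /fam_weight (@fam_exponentE 0 z z) // !big_ord0 addr0 mulr0.
have z_fam N : famN N false z z (fun=> z) by split=> // c; case: ifP.
(* With [N] above [w], every family of weight [w] is constant outside the window of radius [N]. *)
apply: weq_glue => w; pose N := Num.bound w.
have [M [C [wC paths_C]]] := paths_rev (sorted_labels N).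
rewrite rev_labels in paths_C.
have comm la m L' : interlace la la -> interlace m m -> vanish L' la ->
    weq (famN N true la m) (fam_weight true)
        (famN N false la m `*` C) (pair_weight (fam_weight false) wC).
  move=> laI mI laL; apply: weq_trans (famN_paths N true laI mI) _.
  apply: weq_trans (paths_C _ _ _ laL) _.
  by apply: weq_prod (weq_refl _ _); apply/weq_sym/famN_paths.
(* For zero endpoints the reverse side is a single family of weight 0, so [C] itself is in bijection
   with the families of plane partitions in the window. *)
have C_pp : weq (famN N true z z) (fam_weight true) C wC.
  apply: weq_trans (comm _ _ _ zI zI zL) _.
  apply: (@weq_set1l _ _ (fun=> z)) => // k [kS kN].
  by apply: fam_z; split=> //; exists N.
exists (famN N true lam mu), (famN N false lam mu `*` famN N true z z).
have famNW b la m : famN N b la m `<=` fam b la m.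
  by move=> k [kS kN]; split=> //; exists N.
split.
- exact: famNW.
- by move=> [k k'] [/= /famNW ? /famNW ?].
- move=> k kF kw; have [k0 _] := fam_weight_ge kF lamL.
  apply: (fam_lim_of_weight kF lamL).
  by rewrite kw; apply/ltW/archi_boundP; rewrite -kw.
- move=> [k k'] [/= kF kF'] kw.
  have [k0 _] := fam_weight_ge kF lamL; have [k0' _] := fam_weight_ge kF' zL.
  (* Both weights are nonnegative, so the bound on their sum holds for each of them. *)
  have wN : w <= N%:R.
    by apply/ltW/archi_boundP; rewrite -kw addr_ge0.
  rewrite /pair_weight /= in kw.
  split; [apply: (fam_lim_of_weight kF lamL)|apply: (fam_lim_of_weight kF' zL)]; lra.
- apply: weq_trans (comm _ _ _ lamI muI lamL) _.
  by apply: weq_prod (weq_refl _ _) (weq_sym C_pp).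
Qed.

(** * Differences of exponents as sums of differences of entries *)

Lemma sum_by_parts M (a : rat) (d : nat -> rat) :
  \sum_(t < M) (a - t%:R) * (d t.+1 - d t) =
  \sum_(t < M) d t + (a - M%:R + 1) * d M - (a + 1) * d 0%N.
Proof.
elim: M => [|M IH]; first by rewrite !big_ord0; ring.
by rewrite !big_ord_recr /= IH -natr1; ring.
Qed.

(** Consecutive coefficients differ by 1, so summation by parts counts each diagonal once. The
    boundary terms vanish because both families have the same limits. *)
Lemma fam_exponentB N L lam mu k k' :
  fam_lim N lam mu k -> fam_lim N lam mu k' ->
  (forall c, vanish L (k c)) -> (forall c, vanish L (k' c)) ->
  fam_exponent k - fam_exponent k' =
  \sum_(x \in [set: int * nat]) ((k x.1 x.2)%:R - (k' x.1 x.2)%:R : rat).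
Proof.
move=> kN k'N kL k'L.
rewrite (fam_exponent_steps kN) (fam_exponent_steps k'N) -sumrB.
pose d (t : nat) := psize (k (t%:Z - N%:Z)) - psize (k' (t%:Z - N%:Z)).
transitivity (\sum_(t < N + N) (N%:R - 1 / 2 - t%:R) * (d t.+1 - d t)).
  apply: eq_bigr => t _; rewrite /d.
  rewrite (_ : t.+1%:Z - N%:Z = t%:Z + 1 - N%:Z); last lia.
  ring.
have d0 : d 0%N = 0 by rewrite /d (kN _).2 ?(k'N _).2 ?subrr //; lia.
have dN : d (N + N)%N = 0 by rewrite /d (kN _).1 ?(k'N _).1 ?subrr //; lia.
rewrite sum_by_parts d0 dN !mulr0 addr0 subr0.
(* A finite box outside which the two families agree. *)
pose r := [seq (t%:Z - N%:Z, i) | t <- iota 0 (N + N), i <- iota 0 L].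
have mem_r x : x \in r = [&& - N%:Z <= x.1, x.1 < N%:Z & (x.2 < L)%N].
  apply/allpairsP/idP => [[[t i] [/=]]|/and3P[]].
    by rewrite !mem_iota => tN iL -> /=; lia.
  case: x => c i /= *; exists (absz (c + N%:Z), i); rewrite !mem_iota /=.
  by split; first lia; first lia; congr pair; lia.
rewrite (fsbigE r) //; first last.
- move=> [c i] _; rewrite mem_r /= => cr.
  have [iL|iL] := leqP L i; first by rewrite kL ?k'L ?subrr.
  have [cN|cN] := lerP N%:Z c; first by rewrite (kN _).1 ?(k'N _).1 ?subrr.
  by rewrite (kN _).2 ?(k'N _).2 ?subrr //; lia.
- apply: allpairs_uniq; rewrite ?iota_uniq // => -[t i] [t' i'] _ _ /= [tt' ->].
  by congr pair; lia.
rewrite [RHS]big_mkcond /= /r -[LHS](big_mkord xpredT d) /index_iota subn0 big_allpairs_dep.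
apply: eq_bigr => t _.
rewrite /d (psizeE (kL _)) (psizeE (k'L _)) !natr_sum -sumrB.
rewrite -(big_mkord xpredT (fun i => (k (t%:Z - N%:Z) i)%:R - (k' (t%:Z - N%:Z) i)%:R)).
by rewrite /index_iota subn0; apply: eq_bigr => i _; rewrite in_setT.
Qed.

Lemma minimumE (A : set rat) a : A a -> lbound A a -> minimum A = a.
Proof.
move=> Aa Al; rewrite /minimum; case: xgetP => [b _ [Ab bl]|/(_ a)[]] //.
by apply/eqP; rewrite eq_le; apply/andP; split; [exact: bl|exact: Al].
Qed.

Lemma finite_bounded T (A : set T) (f : T -> nat) : finite_set A ->
  exists N, forall x, A x -> (f x < N)%N.
Proof.
move=> /(finite_image f)/finite_seqP[s sE].
exists (\max_(i <- s) i).+1 => x Ax; rewrite ltnS.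
have : [set` s] (f x) by rewrite -sE; exists x.
by move=> /= fs; rewrite (@leq_bigmax_seq _ s xpredT id).
Qed.

Lemma partition_vanish lam : is_partition lam -> exists L, vanish L lam.
Proof.
move=> [_ /(finite_bounded id)[N H]]; exists N => k Nk.
by apply/eqP/negPn/negP => /H /=; rewrite ltnNge Nk.
Qed.

Lemma partition_interlace lam : is_partition lam -> interlace lam lam.
Proof. by move=> [H _] i. Qed.

(** * Skew plane partitions *)

(** The cell of diagonal [j - i = c] at distance [k] from the boundary of the quadrant, so that [k]
    is the minimum of [i] and [j]. *)
Definition spp_cell (x : int * nat) : nat * nat :=
  match x.1 with
  | Posz m => (x.2, x.2 + m)%N
  | Negz m => (x.2 + m.+1, x.2)%N
  end.

Definition spp_coord (x : nat * nat) : int * nat := (x.2%:Z - x.1%:Z, minn x.1 x.2).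

Lemma spp_coordK : cancel spp_coord spp_cell.
Proof.
move=> [i j]; rewrite /spp_cell /spp_coord /=.
by case E: (j%:Z - i%:Z) => [m|m]; congr pair; lia.
Qed.

Lemma spp_cellK : cancel spp_cell spp_coord.
Proof. by move=> [[m|m] k]; rewrite /spp_cell /spp_coord /=; congr pair; lia. Qed.

Definition spp_fam (s : nat -> nat -> nat) (c : int) (k : nat) : nat :=
  s (spp_cell (c, k)).1 (spp_cell (c, k)).2.

Definition fam_spp (k : int -> nat -> nat) (i j : nat) : nat :=
  k (spp_coord (i, j)).1 (spp_coord (i, j)).2.

Lemma spp_famE s (i j k : nat) (c : int) :
  j%:Z - i%:Z = c -> minn i j = k -> spp_fam s c k = s i j.
Proof. by move=> <- <-; rewrite /spp_fam -/(spp_coord (i, j)) spp_coordK. Qed.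

Lemma spp_famK s : fam_spp (spp_fam s) = s.
Proof. by apply/funext => i; apply/funext => j; apply: spp_famE. Qed.

Lemma fam_sppK k : spp_fam (fam_spp k) = k.
Proof.
apply/funext => c; apply/funext => n.
by rewrite /spp_fam /fam_spp -surjective_pairing spp_cellK.
Qed.

Lemma spp_diagE s c : spp_diag s c = psize (spp_fam s c).
Proof.
rewrite /spp_diag /psize (reindex_fsbig (fun k => spp_cell (c, k)) setT) //.
split=> [k _|k k' _ _|x /= xc].
- by have := congr1 fst (spp_cellK (c, k)).
- by move=> /(congr1 spp_coord); rewrite !spp_cellK => -[].
- by exists (minn x.1 x.2) => //; rewrite -xc; exact: spp_coordK.
Qed.

Lemma spp_exponentE s : spp_exponent s = fam_exponent (spp_fam s).
Proof.
by congr (_ + _); apply: eq_fsbigr => c _; rewrite !spp_diagE.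
Qed.

Lemma spp_in_fam lam mu s : is_partition lam -> is_partition mu ->
  spp lam mu s -> fam true lam mu (spp_fam s).
Proof.
move=> /partition_vanish[L lamL] /partition_vanish[L' muL'] [s1 s2 sb sfin].
split=> [c|].
  case: ifPn => c0 i /=; split.
  - rewrite (@spp_famE s (i + absz c)%N i) ?(@spp_famE s (i + (absz c).-1)%N i); try lia.
    by rewrite (_ : absz c = (absz c).-1.+1) ?addnS //; lia.
  - by rewrite (@spp_famE s (i + absz c)%N i.+1) ?(@spp_famE s (i + absz c)%N i) //; lia.
  - rewrite (@spp_famE s i (i + absz c).+1) ?(@spp_famE s i (i + absz c)%N) //; lia.
  - by rewrite (@spp_famE s i.+1 (i + absz c).+1) ?(@spp_famE s i (i + absz c).+1) //; lia.
have [N sN] := finite_bounded (fun x => x.1 + x.2)%N sfin.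
have tight i j : (N <= i + j)%N -> s i j = spp_bound lam mu i j.
  move=> Nij; apply/eqP; rewrite eqn_leq sb leqNgt andbT.
  by apply/negP => /(sN (i, j)) /=; lia.
(* Beyond [N] the entries equal their bound; beyond [L] or [L'] one of the two terms of its maximum
   is zero. *)
exists (N + L + L')%N => c; split=> cN; apply/funext => k.
  rewrite (@spp_famE s k (k + absz c)%N) ?tight /spp_bound ?lamL ?max0n //; lia.
rewrite (@spp_famE s (k + absz c)%N k) ?tight /spp_bound ?muL' ?maxn0 //; lia.
Qed.

Lemma fam_in_spp lam mu k : is_partition lam ->
  fam true lam mu k -> spp lam mu (fam_spp k).
Proof.
move=> /partition_vanish[L lamL] kF.
have [L' kL] := fam_vanish kF lamL; case: kF => kS [N kN].
set s := fam_spp k.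
have kE (i j n : nat) (c : int) : j%:Z - i%:Z = c -> minn i j = n -> s i j = k c n.
  by move=> <- <-.
have s1 i j : (s i.+1 j <= s i j)%N.
  rewrite (kE i j _ _ erefl erefl).
  have := kS (j%:Z - i%:Z - 1); rewrite subrK; case: ifPn => c0 /=.
    move=> /(_ j)[+ _]; rewrite (kE i.+1 j j (j%:Z - i%:Z - 1)); try lia.
    by rewrite (_ : minn i j = j) //; lia.
  move=> /(_ i)[_]; rewrite (kE i.+1 j i.+1 (j%:Z - i%:Z - 1)); try lia.
  by rewrite (_ : minn i j = i) //; lia.
have s2 i j : (s i j.+1 <= s i j)%N.
  rewrite (kE i j _ _ erefl erefl).
  have := kS (j%:Z - i%:Z); case: ifPn => c0 /=.
    move=> /(_ j)[_]; rewrite (kE i j.+1 j.+1 (j%:Z - i%:Z + 1)); try lia.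
    by rewrite (_ : minn i j = j) //; lia.
  move=> /(_ i)[+ _]; rewrite (kE i j.+1 i (j%:Z - i%:Z + 1)); try lia.
  by rewrite (_ : minn i j = i) //; lia.
have s1m i j m : (s (i + m) j <= s i j)%N.
  by elim: m => [|m]; rewrite ?addn0 // addnS; exact/leq_trans/s1.
have s2m i j m : (s i (j + m) <= s i j)%N.
  by elim: m => [|m]; rewrite ?addn0 // addnS; exact/leq_trans/s2.
(* Going down the column reaches a diagonal at or below [- N], where the entry is [lam j]. *)
have lam_le i j : (lam j <= s i j)%N.
  apply: leq_trans (s1m i j (N + j)%N).
  rewrite (kE _ j j (j%:Z - (i + (N + j))%N%:Z)) //; last lia.
  by rewrite (kN _).2 //; lia.
have mu_le i j : (mu i <= s i j)%N.
  apply: leq_trans (s2m i j (N + i)%N).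
  rewrite (kE i _ i ((j + (N + i))%N%:Z - i%:Z)) //; last lia.
  by rewrite (kN _).1 //; lia.
split=> // [i j|]; first by rewrite geq_max lam_le mu_le.
(* An entry above its bound has $|j - i| < N$ and lies at a position below [L'] on its diagonal. *)
apply: (@sub_finite_set _ _ (`I_(N + L') `*` `I_(N + L'))); last first.
  by apply: finite_setX; exact: finite_II.
move=> [i j] /=; rewrite (kE i j _ _ erefl erefl) => sij.
have [cN|cN] := lerP N%:Z (j%:Z - i%:Z).
  by move: sij; rewrite (kN _).1 // /spp_bound (_ : minn i j = i); lia.
have [cN'|cN'] := lerP (j%:Z - i%:Z) (- N%:Z).
  by move: sij; rewrite (kN _).2 // /spp_bound (_ : minn i j = j); lia.
have [L'ij|L'ij] := leqP L' (minn i j); first by rewrite kL in sij.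
by split; lia.
Qed.

Lemma spp_bound_spp lam mu : is_partition lam -> is_partition mu ->
  spp lam mu (spp_bound lam mu).
Proof.
move=> [lamS _] [muS _]; split=> // [i j|i j|].
- by rewrite /spp_bound geq_max !leq_max leqnn muS orbT.
- by rewrite /spp_bound geq_max !leq_max leqnn lamS orbT.
- by rewrite (_ : [set x | _] = set0) //; apply/seteqP; split=> x //=; rewrite ltnn.
Qed.

Lemma fam_exponent_diff b lam mu k k' L :
  fam b lam mu k -> fam b lam mu k' -> vanish L lam ->
  fam_exponent k - fam_exponent k' =
  \sum_(x \in [set: int * nat]) ((k x.1 x.2)%:R - (k' x.1 x.2)%:R : rat).
Proof.
move=> kF k'F lamL.
have [L1 kL] := fam_vanish kF lamL; have [L2 k'L] := fam_vanish k'F lamL.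
have [_ [N kN]] := kF; have [_ [N' k'N]] := k'F.
apply: (@fam_exponentB (N + N') (L1 + L2) lam mu).
- exact: fam_limW (leq_addr _ _) kN.
- exact: fam_limW (leq_addl _ _) k'N.
- by move=> c; apply: vanishW (kL c); exact: leq_addr.
- by move=> c; apply: vanishW (k'L c); exact: leq_addl.
Qed.

(** The excess over the minimal configuration is a difference of exponents. It is nonnegative, which
    identifies [V0] with the exponent of [spp_bound], and adding it back gives the exponent of
    [s]. *)
Lemma spp_weightE lam mu s : is_partition lam -> is_partition mu ->
  spp lam mu s -> spp_weight lam mu s = fam_weight true (spp_fam s).
Proof.
move=> lamP muP sS; have bS := spp_bound_spp lamP muP.
have [L lamL] := partition_vanish lamP.
have excess t : spp lam mu t -> \sum_(x \in [set: nat * nat])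
    ((t x.1 x.2)%:R - (spp_bound lam mu x.1 x.2)%:R : rat) =
    spp_exponent t - spp_exponent (spp_bound lam mu).
  move=> tS; have tF := spp_in_fam lamP muP tS.
  rewrite !spp_exponentE (fam_exponent_diff tF (spp_in_fam lamP muP bS) lamL).
  by apply: reindex_fsbigT; exists spp_coord; [exact: spp_cellK|exact: spp_coordK].
have -> : spp_weight lam mu s = V0 lam mu + (spp_exponent s - spp_exponent (spp_bound lam mu)).
  by rewrite -excess.
rewrite /V0 (@minimumE _ (spp_exponent (spp_bound lam mu))).
- by rewrite addrC subrK spp_exponentE /fam_weight mul1r.
- by exists (spp_bound lam mu).
- move=> _ [t tS <-]; rewrite -subr_ge0 -excess // fsumr_ge0 // => x _.
  by rewrite subr_ge0 ler_nat; case: tS.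
Qed.

Lemma weq_spp lam mu : is_partition lam -> is_partition mu ->
  weq (spp lam mu) (spp_weight lam mu) (fam true lam mu) (fam_weight true).
Proof.
move=> lamP muP; exists spp_fam, fam_spp; split.
- by move=> s sS; rewrite spp_famK; split=> //; exact: spp_in_fam.
- by move=> k kF; rewrite fam_sppK; split=> //; exact: fam_in_spp.
- by move=> s sS; rewrite spp_weightE.
Qed.

Lemma plane_partitionE : plane_partition = spp (fun=> 0%N) (fun=> 0%N).
Proof.
apply/funext => p; apply/propext; rewrite /plane_partition /spp /spp_bound /=.
have -> : [set x : nat * nat | p x.1 x.2 != 0%N] = [set x | (maxn 0 0 < p x.1 x.2)%N].
  by apply/seteqP; split=> x /=; rewrite max0n lt0n.
by split=> [[]|[]]; split.
Qed.

Lemma pp_weightE p : plane_partition p ->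
  pp_weight p = spp_weight (fun=> 0%N) (fun=> 0%N) p.
Proof.
rewrite plane_partitionE => pS; have zP : is_partition (fun=> 0%N).
  by split=> //; rewrite (_ : [set i | _] = set0) //; apply/seteqP; split=> x.
have bS := spp_bound_spp zP zP.
(* Evaluation at the minimal configuration, whose diagonals are all zero, shows that [V0] is 0 for
   the empty shape. *)
have := spp_weightE zP zP bS; rewrite /spp_weight fsbig1 => [|x _]; last exact: subrr.
rewrite /fam_weight (@fam_exponentE 0 (fun=> 0%N) (fun=> 0%N)); last first.
  by move=> c; split=> _; apply/funext => k; rewrite /spp_fam /spp_bound maxnn.
rewrite !big_ord0 !addr0 mulr0 => ->; rewrite add0r /pp_weight.
by apply: eq_fsbigr => x _; rewrite /spp_bound maxnn subr0.
Qed.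

(** * Reverse plane partitions *)

(** The cell with [i - j = c] whose larger coordinate is [k]; the domain consists of the cells whose
    larger coordinate is nonnegative. *)
Definition rpp_point (c : int) (k : nat) : int * int :=
  (k%:Z + Num.min c 0, k%:Z - Num.max c 0).

Lemma rpp_point_dom c k : (0 <= (rpp_point c k).1) || (0 <= (rpp_point c k).2).
Proof. by rewrite /rpp_point /=; lia. Qed.

(* The diagonals are listed by decreasing [j - i], so that they run from [lam]
   to [mu] as those of a skew plane partition do. *)
Definition rpp_cell (x : int * nat) : rpp_dom :=
  exist _ (rpp_point x.1 x.2) (rpp_point_dom x.1 x.2).

Definition rpp_coord (x : rpp_dom) : int * nat :=
  ((val x).1 - (val x).2, absz (Num.max (val x).1 (val x).2)).

Lemma rpp_coordK : cancel rpp_coord rpp_cell.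
Proof.
move=> [[i j] ij]; apply: val_inj; rewrite /= /rpp_point /=; move: ij => /= ij.
by congr pair; lia.
Qed.

Lemma rpp_cellK : cancel rpp_cell rpp_coord.
Proof. by move=> [c k]; rewrite /rpp_coord /= /rpp_point /=; congr pair; lia. Qed.

Definition rpp_fam (r : rpp_dom -> nat) (c : int) (k : nat) : nat := r (rpp_cell (c, k)).

Definition fam_rpp (k : int -> nat -> nat) (x : rpp_dom) : nat :=
  k (rpp_coord x).1 (rpp_coord x).2.

Lemma rpp_famK r : fam_rpp (rpp_fam r) = r.
Proof.
by apply/funext => x; rewrite /fam_rpp /rpp_fam -surjective_pairing rpp_coordK.
Qed.

Lemma fam_rppK k : rpp_fam (fam_rpp k) = k.
Proof.
by apply/funext => c; apply/funext => n; rewrite /rpp_fam /fam_rpp rpp_cellK.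
Qed.

Lemma rpp_diagE r c : rpp_diag r c = psize (rpp_fam r (- c)).
Proof.
rewrite /rpp_diag /psize (reindex_fsbig (fun k => rpp_cell (- c, k)) setT) //.
split=> [k _|k k' _ _|x /= xc].
- by rewrite /= /rpp_point /=; lia.
- by move=> /(congr1 rpp_coord); rewrite !rpp_cellK => -[].
- by exists (rpp_coord x).2 => //; rewrite -[RHS]rpp_coordK -xc opprB.
Qed.

(** Replacing [c] by [- c] swaps the two half sums, and each difference is taken in the opposite
    order; this is the sign in [fam_weight false]. *)
Lemma rpp_exponentE r : rpp_exponent r = fam_weight false (rpp_fam r).
Proof.
have sumN (F : nat -> rat) : - (\sum_(c \in [set: nat]) F c) = \sum_(c \in [set: nat]) - F c.
  by rewrite -mulN1r mulr_fsumr; apply: eq_fsbigr => c _; rewrite mulN1r.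
rewrite /fam_weight mulN1r opprD [RHS]addrC !sumN.
congr (_ + _); apply: eq_fsbigr => c _; rewrite !rpp_diagE -mulrN opprB.
  by rewrite opprD.
by rewrite !opprB opprK [1 + _]addrC.
Qed.

(** Encodes the infinite values of [lam] and [mu] as the absence of a constraint at negative
    indices. *)
Lemma leq_rpp_bound lam mu n (x : int * int) : (0 <= x.1) || (0 <= x.2) ->
  ((n <= rpp_bound lam mu x)%N <->
   (0 <= x.2 -> (n <= lam (absz x.2))%N) /\ (0 <= x.1 -> (n <= mu (absz x.1))%N)).
Proof.
case: x => -[i|i] [j|j] //= _; rewrite /rpp_bound /=.
- by rewrite leq_min; split=> [/andP[]|[-> // ->]].
- by split=> [|[_ ->]].
- by split=> [|[->]].
Qed.

Lemma rpp_in_fam lam mu r : is_partition lam -> is_partition mu ->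
  rpp lam mu r -> fam false lam mu (rpp_fam r).
Proof.
move=> /partition_vanish[L lamL] /partition_vanish[L' muL'] [r1 r2 rb rfin].
split=> [c|].
  case: ifPn => c0 i /=; split.
  - by apply: r1; rewrite /= /rpp_point /=; congr pair; lia.
  - by apply: r2; rewrite /= /rpp_point /=; congr pair; lia.
  - by apply: r2; rewrite /= /rpp_point /=; congr pair; lia.
  - by apply: r1; rewrite /= /rpp_point /=; congr pair; lia.
have [N rN] := finite_bounded (fun x => absz (val x).1 + absz (val x).2)%N rfin.
have tight x : (N <= absz (val x).1 + absz (val x).2)%N ->
    r x = rpp_bound lam mu (val x).
  move=> Nx; apply/eqP; rewrite eqn_leq rb leqNgt.
  by apply/negP => /(rN x); lia.
(* For large [c] the cell is [(k, k - c)]: either its second coordinate is negative and [mu k] alone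
   bounds it, or [k >= c] and [mu k] is 0. The other side is symmetric. *)
exists (N + L + L')%N => c; split=> cN; apply/funext => k;
  rewrite /rpp_fam tight /= /rpp_point /=; try lia;
  have D := rpp_point_dom c k; rewrite /rpp_point /= in D;
  apply/eqP; rewrite eqn_leq; apply/andP; split.
- have [/(_ (leqnn _))[_ +] _] := leq_rpp_bound lam mu (rpp_bound lam mu (rpp_point c k)) (rpp_point_dom c k).
  by rewrite /= (_ : absz _ = k) => [->//|]; lia.
- apply/leq_rpp_bound => //=; split=> ?.
    by rewrite (muL' k) //; lia.
  by rewrite (_ : absz _ = k) //; lia.
- have [/(_ (leqnn _))[+ _] _] := leq_rpp_bound lam mu (rpp_bound lam mu (rpp_point c k)) (rpp_point_dom c k).
  by rewrite /= (_ : absz _ = k) => [->//|]; lia.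
- apply/leq_rpp_bound => //=; split=> ?.
    by rewrite (_ : absz _ = k) //; lia.
  by rewrite (lamL k) //; lia.
Qed.

(** Bounds on the far side of the main diagonal: each growing step away from diagonal 0 lowers the
    part index by one, from [i.+1] to [i], on the way back to it. *)
Lemma fam_false_diag_le lam mu k (c : int) i : fam false lam mu k ->
  (0 <= c -> (k c (i + absz c) <= lam i)%N) /\
  (c <= 0 -> (k c (i + absz c) <= mu i)%N).
Proof.
move=> kF; have [k_lam k_mu] := fam_false_le 0 i kF; have [kS _] := kF.
split=> c0.
  apply: leq_trans (k_lam _) => //.
  have -> : c = (absz c)%:Z by lia.
  elim: (absz c) => [|m IH]; first by rewrite addn0.
  apply: leq_trans IH; have := kS m%:Z.
  rewrite (_ : m%:Z + 1 = m.+1%:Z); last lia.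
  by case/(_ (i + m)%N) => _; rewrite -addnS.
apply: leq_trans (k_mu _) => //.
have -> : c = - (absz c)%:Z by lia.
rewrite abszN; elim: (absz c) => [|m IH]; first by rewrite addn0.
apply: leq_trans IH; have := kS (- m.+1%:Z).
rewrite (_ : - m.+1%:Z + 1 = - m%:Z); last lia.
by case/(_ (i + m)%N) => _; rewrite -addnS.
Qed.

Lemma fam_in_rpp lam mu k : is_partition lam -> is_partition mu ->
  fam false lam mu k -> rpp lam mu (fam_rpp k).
Proof.
move=> /partition_vanish[L lamL] /partition_vanish[L' muL'] kF.
have kb x : (fam_rpp k x <= rpp_bound lam mu (val x))%N.
  case: x => -[i j] ij; apply/leq_rpp_bound; first exact: ij.
  rewrite /fam_rpp /rpp_coord /= in ij *; split=> ?.
  - have [ji|ji] : i <= j \/ j < i by lia.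
      rewrite (_ : Num.max i j = j); last lia.
      by apply: (fam_false_le _ _ kF).1; lia.
    rewrite (_ : absz (Num.max i j) = absz j + absz (i - j))%N; last lia.
    by apply: (fam_false_diag_le _ _ kF).1; lia.
  - have [ji|ji] : j <= i \/ i < j by lia.
      rewrite (_ : Num.max i j = i); last lia.
      by apply: (fam_false_le _ _ kF).2; lia.
    rewrite (_ : absz (Num.max i j) = absz i + absz (i - j))%N; last lia.
    by apply: (fam_false_diag_le _ _ kF).2; lia.
have [kS [N kN]] := kF.
split=> //.
- move=> [[i j] ij] [[i' j'] ij'] /= [? ?]; subst i' j'.
  rewrite /fam_rpp /rpp_coord /= in ij ij' *; have := kS (i - j).
  rewrite (_ : i - j + 1 = i + 1 - j); last lia.
  case: ifPn => c0 /= /(_ (absz (Num.max i j)))[H1 H2].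
    by rewrite (_ : absz (Num.max (i + 1) j) = absz (Num.max i j)) //; lia.
  by rewrite (_ : absz (Num.max (i + 1) j) = (absz (Num.max i j)).+1) //; lia.
- move=> [[i j] ij] [[i' j'] ij'] /= [? ?]; subst i' j'.
  rewrite /fam_rpp /rpp_coord /= in ij ij' *; have := kS (i - (j + 1)).
  rewrite (_ : i - (j + 1) + 1 = i - j); last lia.
  case: ifPn => c0 /= /(_ (absz (Num.max i j)))[H1 H2].
    by rewrite (_ : absz (Num.max i (j + 1)) = (absz (Num.max i j)).+1) //; lia.
  by rewrite (_ : absz (Num.max i (j + 1)) = absz (Num.max i j)) //; lia.
(* An entry below its bound lies within [N] of the main diagonal, and its nonnegative coordinates
   are below [L] or [L']. *)
pose B := (fun n : nat => n%:Z - N%:Z) @` `I_(N + N) `*` `I_(N + L + L').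
apply: (@sub_finite_set _ _ (rpp_cell @` B)); last first.
  by apply/finite_image/finite_setX; [apply: finite_image|]; exact: finite_II.
move=> [[i j] ij] /= r_lt; exists (rpp_coord (exist _ (i, j) ij)); last exact: rpp_coordK.
have [lam_j mu_i] := (leq_rpp_bound lam mu (rpp_bound lam mu (i, j)) ij).1 (leqnn _).
have D := ij; rewrite /= in lam_j mu_i D.
have [cN|cN] := lerP N%:Z (i - j).
  move: r_lt; rewrite /fam_rpp /rpp_coord /= (kN _).1 //.
  have := mu_i; rewrite (_ : Num.max i j = i); last lia.
  by move=> /(_ _); lia.
have [cN'|cN'] := lerP (i - j) (- N%:Z).
  move: r_lt; rewrite /fam_rpp /rpp_coord /= (kN _).2 //.
  have := lam_j; rewrite (_ : Num.max i j = j); last lia.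
  by move=> /(_ _); lia.
split; first by exists (absz (i - j + N%:Z)) => /=; lia.
rewrite /rpp_coord /=.
have i_lt : 0 <= i -> (absz i < L')%N.
  by move=> i0; rewrite ltnNge; apply/negP => /muL'; have := mu_i i0; lia.
have j_lt : 0 <= j -> (absz j < L)%N.
  by move=> j0; rewrite ltnNge; apply/negP => /lamL; have := lam_j j0; lia.
by case: (lerP 0 i) (lerP 0 j) => [/i_lt ?|?] [/j_lt ?|?]; lia.
Qed.

Lemma rpp_bound_rpp lam mu : is_partition lam -> is_partition mu ->
  rpp lam mu (rpp_bound lam mu \o val).
Proof.
move=> [lamS _] [muS _]; split=> //=.
- move=> [[i j] ij] [[i' j'] ij'] /= [? ?]; subst i' j'.
  have [/(_ (leqnn _))[lam_j mu_i] _] := leq_rpp_bound lam mu (rpp_bound lam mu (i + 1, j)) ij'.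
  apply/leq_rpp_bound; [exact: ij|split=> //= i0]; rewrite /= in mu_i.
  apply: leq_trans (mu_i _) _; first lia.
  by rewrite (_ : absz (i + 1) = (absz i).+1) //; lia.
- move=> [[i j] ij] [[i' j'] ij'] /= [? ?]; subst i' j'.
  have [/(_ (leqnn _))[lam_j mu_i] _] := leq_rpp_bound lam mu (rpp_bound lam mu (i, j + 1)) ij'.
  apply/leq_rpp_bound; [exact: ij|split=> //= j0]; rewrite /= in lam_j.
  apply: leq_trans (lam_j _) _; first lia.
  by rewrite (_ : absz (j + 1) = (absz j).+1) //; lia.
- by rewrite (_ : [set x | _] = set0) //; apply/seteqP; split=> x //=; rewrite ltnn.
Qed.

(** As for skew plane partitions, with the difference reversed: entries lie below the bound and the
    exponent carries a minus sign. *)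
Lemma rpp_weightE lam mu r : is_partition lam -> is_partition mu ->
  rpp lam mu r -> rpp_weight lam mu r = fam_weight false (rpp_fam r).
Proof.
move=> lamP muP rS; have bS := rpp_bound_rpp lamP muP.
have [L lamL] := partition_vanish lamP.
have excess t : rpp lam mu t -> \sum_(x \in [set: rpp_dom])
    ((rpp_bound lam mu (val x))%:R - (t x)%:R : rat) =
    rpp_exponent t - rpp_exponent (rpp_bound lam mu \o val).
  move=> tS; have tF := rpp_in_fam lamP muP tS.
  rewrite !rpp_exponentE /fam_weight !mulN1r opprK addrC.
  rewrite (fam_exponent_diff (rpp_in_fam lamP muP bS) tF lamL).
  by apply: reindex_fsbigT; exists rpp_coord; [exact: rpp_cellK|exact: rpp_coordK].
rewrite /rpp_weight excess // /W0 (@minimumE _ (rpp_exponent (rpp_bound lam mu \o val))).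
- by rewrite addrC subrK rpp_exponentE.
- by exists (rpp_bound lam mu \o val).
- move=> _ [t tS <-]; rewrite -subr_ge0 -excess // fsumr_ge0 // => x _.
  by rewrite subr_ge0 ler_nat; case: tS.
Qed.

Lemma weq_rpp lam mu : is_partition lam -> is_partition mu ->
  weq (rpp lam mu) (rpp_weight lam mu) (fam false lam mu) (fam_weight false).
Proof.
move=> lamP muP; exists rpp_fam, fam_rpp; split.
- by move=> r rS; rewrite rpp_famK; split=> //; exact: rpp_in_fam.
- by move=> k kF; rewrite fam_rppK; split=> //; exact: fam_in_rpp.
- by move=> r rS; rewrite rpp_weightE.
Qed.

(** * From families of diagonals back to the three kinds of arrays *)

Theorem theorem5p4 (lam mu : nat -> nat)
  (hlam : is_partition lam) (hmu : is_partition mu) :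
  exists f : (nat -> nat -> nat) -> (rpp_dom -> nat) * (nat -> nat -> nat),
    set_bij (spp lam mu) (rpp lam mu `*` plane_partition) f /\
    (forall s, spp lam mu s ->
       spp_weight lam mu s = rpp_weight lam mu (f s).1 + pp_weight (f s).2).
Proof.
have zP : is_partition (fun=> 0%N).
  by split=> //; rewrite (_ : [set i | _] = set0) //; apply/seteqP; split=> x.
have [L lamL] := partition_vanish hlam.
have [f [g [fP gP wP]]] : weq (spp lam mu) (spp_weight lam mu)
    (rpp lam mu `*` plane_partition) (pair_weight (rpp_weight lam mu) pp_weight).
  apply: weq_trans (weq_spp hlam hmu) _.
  apply: weq_trans (fam_commute (partition_interlace hlam) (partition_interlace hmu) lamL) _.
  apply: weq_prod; first exact/weq_sym/weq_rpp.
  (* Families with zero endpoints are the skew plane partitions of empty shape, that is, the plane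
     partitions. *)
  rewrite plane_partitionE; apply/weq_sym; apply: eq_weq (weq_spp zP zP) => //.
  by move=> p pP; rewrite pp_weightE // plane_partitionE.
exists f; split; last by move=> s /wP <-.
split=> [s /fP[]//|s s' /set_mem/fP[_ {2}<-] /set_mem/fP[_ {2}<-] -> //|x /gP[gx fx]].
by exists (g x).
Qed.
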